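(* Let $n\ge 1$ and consider the complementary summing register $\mathrm{CSR}_n$, i.e. the $n$-stage feedback shift register with feedback function $f_C(x_1,x_2,\dots,x_n)=1\oplus x_1\oplus x_2\oplus\cdots\oplus x_n$. For a positive integer $e$ let $M^*(e)$ denote the number of cycles of length $e$ of $\mathrm{CSR}_n$. (1) If $n$ is even and $d\mid (n+1)$, then $$M^*(d)=\frac{1}{2d}\sum_{d'\mid d}\mu(d')\,2^{d/d'}.$$ (2) If $n$ is odd, write $n+1=2^k m$ with $m$ odd. If $d\mid m$, then the number of cycles of length $2^k d$ is $$M^*(2^k d)=\frac{1}{2^{k+1}d}\sum_{d'\mid d}\mu(d')\,2^{2^k d/d'}.$$ Equivalently, if $n$ is odd, $d\mid (n+1)$ and $\frac{n+1}{d}$ is odd, then the number of cycles of length $d$ is $$M^*(d)=\frac{1}{2d}\sum_{\substack{d'\mid d\\ d'\text{ odd}}}\mu(d')\,2^{d/d'}.$$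
   Context: $F_2$ is the field with two elements, $\oplus$ is addition modulo 2, and $\mu$ is the Möbius function. The $n$-stage feedback shift register (FSR) with feedback function $f:F_2^n\to F_2$ has state set $F_2^n$ and next-state operator $\rho:F_2^n\to F_2^n$, $\rho(a_1,\dots,a_n)=(a_2,\dots,a_n,f(a_1,\dots,a_n))$. A cycle of length $l$ is a cyclic sequence of $l$ distinct states $(S_i,S_{i+1},\dots,S_{i+l-1})$ with $S_{i+j+1}=\rho S_{i+j}$ for $0\le j\le l-2$ and $S_i=\rho S_{i+l-1}$ (cycles are considered up to cyclic rotation, i.e. they are the orbits of $\rho$ when $\rho$ is bijective). Sums over $d'\mid d$ run over the positive divisors of $d$. *)

(* Defs.v *)
From mathcomp Require Export all_boot all_order all_algebra.

Set Implicit Arguments.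
Unset Strict Implicit.
Unset Printing Implicit Defensive.

Import GRing.Theory.
Local Open Scope ring_scope.

Definition moebius (n : nat) : int :=
  if (n == 0)%N || has (fun p => (p ^ 2 %| n)%N) (primes n) then 0
  else (-1) ^+ size (primes n).

Section FeedbackShiftRegister.
Variable n : nat.

(* The component a_{i+1} of a state, 1-indexed, is the entry a 0 i. *)
Definition state := 'rV['F_2]_n.

(* [insub i.+1 : option 'I_n] is None exactly when i is the last index; there
   the new entry is the feedback value. *)
Definition fsr_next (f : state -> 'F_2) (a : state) : state :=
  \row_(i < n) (if insub i.+1 is Some j then a 0 j else f a).

Definition fsr_cycle_seqs (f : state -> 'F_2) (l : nat) : {set l.-tuple state} :=
  [set s : l.-tuple state | fcycle (fsr_next f) s && uniq s].

Definition rot_equiv (l : nat) : rel (l.-tuple state) :=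
  fun s t => [exists i : 'I_l, t == rot i s :> seq state].

(* The cycles of length l: cyclic sequences up to rotation. Meaningful only for
   0 < l, where rot_equiv is an equivalence relation. *)
Definition fsr_cycles (f : state -> 'F_2) (l : nat) :
    {set {set l.-tuple state}} :=
  equivalence_partition (@rot_equiv l) (fsr_cycle_seqs f l).

Definition csr_feedback (x : state) : 'F_2 := 1 + \sum_(i < n) x 0 i.

End FeedbackShiftRegister.

Definition csr_num_cycles (n e : nat) : nat := #|fsr_cycles (@csr_feedback n) e|.

(* Main.v *)
Require Import Defs.
From mathcomp Require Import all_boot all_order all_algebra.

Set Implicit Arguments.
Unset Strict Implicit.
Unset Printing Implicit Defensive.

Import GRing.Theory.
Local Open Scope ring_scope.

(** Appending to a state a of CSR_n its feedback bit 1 + a_1 + ... + a_n gives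
    a word of length n+1 whose entries sum to 1, and every such word arises
    exactly once. Computing the feedback of the next state gives back a_1, so
    the register acts on these words as the cyclic shift of length n+1
    ([csr_word_next]): its dynamics is that of rotating the odd-weight words.

    For d dividing n+1, a state satisfies rho^d a = a iff its word is
    d-periodic, that is, iff the word repeats (n+1)/d times a block of length d.
    The weight of the whole word is then (n+1)/d times that of the block, so
    there is no such state when (n+1)/d is even, while for (n+1)/d odd the
    blocks are the words of length d of odd weight, i.e. the words of CSR_(d-1):
    there are 2^(d-1) of them ([card_csr_iter_fix]).

    A cycle of length l consists of l states of exact period l
    ([card_fsr_cycles]), and the states fixed by rho^d are those whose exact
    period divides d ([card_iter_fix]). Moebius inversion then expresses
    d M*(d) through the numbers of states fixed by rho^(d/d'). When (n+1)/d is
    odd, the cofactor of d/d' in n+1 has the parity of d', so only odd d'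
    contribute ([csr_num_cyclesE]). All the formulas are instances: if n is even
    all divisors of n+1 are odd, and if d is odd the odd divisors of 2^k d are
    the divisors of d. *)

(** * Moebius inversion *)

Lemma big_divisors_dvdn (R : nmodType) (F : nat -> R) (d e : nat) :
    (0 < d)%N -> (e %| d)%N ->
  \sum_(c <- divisors e) F c = \sum_(c <- divisors d | (c %| e)%N) F c.
Proof.
move=> d_gt0 e_dvd; have e_gt0 := dvdn_gt0 d_gt0 e_dvd.
rewrite -[RHS]big_filter; apply: perm_big; apply: uniq_perm.
- exact: divisors_uniq.
- exact/filter_uniq/divisors_uniq.
move=> c; rewrite mem_filter -!dvdn_divisors //.
by apply: esym; apply: andb_idr => /dvdn_trans; apply.
Qed.

Lemma moebius_sqr_dvdn (p n : nat) :
  prime p -> (p ^ 2 %| n)%N -> moebius n = 0.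
Proof.
rewrite /moebius; case: (posnP n) => [-> //|n_gt0] p_pr pn.
suff -> : has (fun q => q ^ 2 %| n)%N (primes n) by [].
apply/hasP; exists p => //.
by rewrite mem_primes p_pr n_gt0 (dvdn_trans _ pn) // dvdn_exp.
Qed.

Lemma moebius_primeM (p e : nat) :
  prime p -> ~~ (p %| e)%N -> moebius (p * e) = - moebius e.
Proof.
move=> p_pr pNe; have p_gt0 := prime_gt0 p_pr.
have e_gt0 : (0 < e)%N by case: e pNe => //; rewrite dvdn0.
have primes_pe : perm_eq (primes (p * e)) (p :: primes e).
  apply: uniq_perm; rewrite /= ?primes_uniq ?mem_primes ?(negPf pNe) ?andbF //.
  by move=> q; rewrite in_cons primesM // primes_prime // mem_seq1.
have sqr_pe : has (fun q => q ^ 2 %| p * e)%N (primes (p * e)) =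
              has (fun q => q ^ 2 %| e)%N (primes e).
  rewrite (perm_has _ primes_pe) /= expnS dvdn_pmul2l // expn1 (negPf pNe) /=.
  apply: eq_in_has => q; rewrite mem_primes => /and3P[q_pr _ qe].
  rewrite Gauss_dvdr // coprimeXl // prime_coprime // dvdn_prime2 //.
  by apply: contraNN pNe => /eqP <-.
rewrite /moebius muln_eq0 !eqn0Ngt p_gt0 e_gt0 /= sqr_pe (perm_size primes_pe).
by case: ifP; rewrite ?oppr0 //= exprS mulN1r.
Qed.

(** If p is a prime divisor of n, the divisors of n that are multiples of p^2
    contribute 0, and the others cancel in pairs e, p * e with p not dividing
    e. *)
Lemma sum_moebius_divisors (n : nat) :
  (0 < n)%N -> \sum_(d <- divisors n) moebius d = (n == 1%N)%:R.
Proof.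
move=> n_gt0; case: eqP => [-> | /eqP n_neq1].
  by rewrite (_ : divisors 1 = [:: 1%N]) // big_seq1.
have n_gt1 : (1 < n)%N by case: n n_gt0 n_neq1 => [|[]].
pose p := pdiv n; have p_pr : prime p := pdiv_prime n_gt1.
have p_gt0 := prime_gt0 p_pr.
rewrite (bigID (fun d => p %| d)%N) /= (bigID (fun d => p ^ 2 %| d)%N) /=.
rewrite big1 ?add0r => [|d /andP[_ /(moebius_sqr_dvdn p_pr)] //].
suff -> : \sum_(d <- divisors n | (p %| d)%N && ~~ (p ^ 2 %| d)%N) moebius d =
          \sum_(d <- [seq p * e | e <- divisors n & ~~ (p %| e)]%N) moebius d.
  rewrite big_map big_filter -big_split big1 //= => e pNe.
  by rewrite moebius_primeM // addNr.
rewrite -big_filter; apply: perm_big; apply: uniq_perm.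
- exact/filter_uniq/divisors_uniq.
- rewrite map_inj_uniq; first exact/filter_uniq/divisors_uniq.
  by move=> x y /eqP; rewrite eqn_pmul2l // => /eqP.
move=> d; rewrite mem_filter -dvdn_divisors //.
apply/idP/mapP => [/andP[/andP[/dvdnP[e ->]]] | [e]].
  rewrite mulnC expnS dvdn_pmul2l // expn1 => pNe pe_dvd; exists e => //.
  by rewrite mem_filter pNe -dvdn_divisors // (dvdn_trans _ pe_dvd) // dvdn_mull.
rewrite mem_filter -dvdn_divisors // => /andP[pNe en] ->.
rewrite expnS dvdn_pmul2l // expn1 pNe dvdn_mulr //=.
by rewrite Gauss_dvd ?pdiv_dvd // prime_coprime.
Qed.

(** After exchanging the two sums, the coefficient of A c is the sum of the
    Moebius function over the divisors of d/c, which vanishes unless c = d. *)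
Lemma moebius_inversion (R : pzRingType) (A F : nat -> R) (d : nat) :
    (0 < d)%N ->
    (forall e, (e %| d)%N -> F e = \sum_(c <- divisors e) A c) ->
  A d = \sum_(e <- divisors d) (moebius e)%:~R * F (d %/ e)%N.
Proof.
move=> d_gt0 defF.
have -> : \sum_(e <- divisors d) (moebius e)%:~R * F (d %/ e)%N =
    \sum_(e <- divisors d) \sum_(c <- divisors d | (c * e %| d)%N)
      (moebius e)%:~R * A c.
  apply: eq_big_seq => e; rewrite -dvdn_divisors // => e_dvd.
  have e_gt0 := dvdn_gt0 d_gt0 e_dvd.
  rewrite defF ?dvdn_div // (big_divisors_dvdn _ d_gt0) ?dvdn_div // big_distrr.
  by apply: eq_bigl => c; rewrite dvdn_divRL.
have -> : A d = \sum_(c <- divisors d) (c == d)%:R * A c.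
  rewrite (bigD1_seq d) ?divisors_id ?divisors_uniq //= eqxx mul1r big1 ?addr0 //.
  by move=> c /negPf->; rewrite mul0r.
rewrite (exchange_big_dep predT) //=; apply: eq_big_seq => c.
rewrite -dvdn_divisors // => c_dvd; have c_gt0 := dvdn_gt0 d_gt0 c_dvd.
rewrite -big_distrl /=; congr (_ * _).
have dc_gt0 : (0 < d %/ c)%N by rewrite divn_gt0 // dvdn_leq.
have -> : (c == d) = (d %/ c == 1)%N.
  by rewrite -[RHS](eqn_pmul2r c_gt0) divnK // mul1n eq_sym.
transitivity ((\sum_(e <- divisors (d %/ c)) moebius e)%:~R : R).
  by rewrite sum_moebius_divisors // rmorph_nat.
rewrite rmorph_sum (big_divisors_dvdn _ d_gt0) ?dvdn_div //.
by apply: eq_bigl => e; rewrite dvdn_divRL // mulnC.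
Qed.

(** * Orbits of an injective map and cycles of a register *)

Lemma iter_eq_order (T : finType) (f : T -> T) (m : nat) (x : T) :
  injective f -> (iter m f x == x) = (order f x %| m)%N.
Proof.
move=> f_inj; have o_gt0 := order_gt0 f x.
have fix_mul q : iter (q * order f x) f x = x.
  by elim: q => // q IHq; rewrite mulSn iterD IHq iter_order.
rewrite {1}(divn_eq m (order f x)) addnC iterD fix_mul.
apply/eqP/idP => [fix_x|/eqP-> //].
have := findex_iter (ltn_pmod m o_gt0).
by rewrite fix_x findex0 /dvdn => <-.
Qed.

Lemma card_iter_fix (T : finType) (f : T -> T) (m : nat) :
    injective f -> (0 < m)%N ->
  #|[set x | iter m f x == x]| =
    (\sum_(e <- divisors m) #|[set x | order f x == e]|)%N.
Proof.
move=> f_inj m_gt0; rewrite -sum1_card.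
under eq_bigl do rewrite inE iter_eq_order //.
under [RHS]eq_bigr do rewrite -sum1_card.
rewrite (exchange_big_dep xpredT) //= big_mkcond /=.
apply: eq_bigr => x _; under eq_bigl do rewrite inE.
rewrite dvdn_divisors // sum1_count.
rewrite (eq_count (a2 := pred1 (order f x))); last by move=> e; rewrite /= eq_sym.
by rewrite count_uniq_mem ?divisors_uniq //; case: (_ \in _).
Qed.

Section Cycles.
Variables (n : nat) (f : state n -> 'F_2) (l : nat).
Hypotheses (next_inj : injective (fsr_next f)) (l_gt0 : (0 < l)%N).

Definition cycle_from (x : state n) : l.-tuple (state n) :=
  Tuple (introT eqP (size_traject (fsr_next f) x l)).

Lemma cycle_from_inj : injective cycle_from.
Proof.
by move=> x y /(congr1 (head x \o val)) /=; case: l l_gt0.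
Qed.

(** The listing of a cycle is determined by its first state, so its rotations
    correspond to the choices of a first state. *)
Lemma rot_fsr_cycle (s : l.-tuple (state n)) (x0 : state n) (i : nat) :
    s \in fsr_cycle_seqs f l -> (i < l)%N ->
  rot i s = cycle_from (nth x0 s i).
Proof.
rewrite inE => /andP[cyc_s _] lt_il.
have : fcycle (fsr_next f) (rot i s) by rewrite rot_cycle.
have : size (rot i s) = l by rewrite size_rot size_tuple.
rewrite /rot (drop_nth x0); last by rewrite size_tuple.
rewrite cat_cons.
move: (nth _ _ _) (drop _ _ ++ _) => x t sz_t.
rewrite /= rcons_path => /andP[/fpathE def_t _].
by rewrite -sz_t /= -def_t.
Qed.

Lemma order_fsr_cycle (s : l.-tuple (state n)) (x : state n) :
  s \in fsr_cycle_seqs f l -> x \in s -> order (fsr_next f) x = l.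
Proof.
rewrite inE => /andP[cyc_s uniq_s] xs.
by rewrite (order_cycle cyc_s uniq_s xs) size_tuple.
Qed.

Lemma cycle_from_orbit (x : state n) :
  order (fsr_next f) x = l -> cycle_from x = orbit (fsr_next f) x :> seq _.
Proof. by rewrite /orbit /= => ->. Qed.

Lemma mem_rot_fsr_cycle (s t : l.-tuple (state n)) :
    s \in fsr_cycle_seqs f l ->
  rot_equiv s t = (t \in [seq cycle_from x | x <- s]).
Proof.
move=> sD; apply/existsP/mapP => [[i /eqP def_t] | [x xs ->]].
  pose x0 : state n := 0.
  exists (nth x0 s i); first by rewrite mem_nth // size_tuple.
  by apply: val_inj; rewrite /= def_t (rot_fsr_cycle x0).
have lt_xl : (index x s < l)%N by rewrite -[l in (_ < l)%N](size_tuple s) index_mem.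
exists (Ordinal lt_xl); apply/eqP.
by rewrite (rot_fsr_cycle x) // nth_index.
Qed.

Lemma fsr_cycle_seqsE :
  fsr_cycle_seqs f l = cycle_from @: [set x | order (fsr_next f) x == l].
Proof.
apply/setP => s; apply/idP/imsetP => [sD | [x]].
  exists (nth 0 s 0).
    by rewrite inE (order_fsr_cycle sD) // mem_nth // size_tuple.
  by apply: val_inj; rewrite /= -[LHS]rot0 (rot_fsr_cycle 0).
rewrite !inE => /eqP x_l ->.
by rewrite cycle_from_orbit // cycle_orbit // orbit_uniq.
Qed.

(** In this form it is visible that [rot_equiv] is an equivalence relation on
    the listings of cycles. *)
Lemma rot_equivE : {in fsr_cycle_seqs f l &, forall s t : l.-tuple (state n),
  rot_equiv s t = ([set x in s] == [set x in t])}.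
Proof.
move=> s t sD tD; apply/idP/eqP => [/existsP[i /eqP def_t] | eq_st].
  by apply/setP => x; rewrite !inE !memtE def_t mem_rot.
rewrite (mem_rot_fsr_cycle t sD); apply/mapP; exists (nth 0 t 0).
  have /setP/(_ (nth 0 t 0)) := eq_st.
  by rewrite !inE mem_nth ?size_tuple.
by apply: val_inj; rewrite /= -[LHS]rot0 (rot_fsr_cycle 0).
Qed.

(** Listings of cycles correspond to states of exact period l through their
    first states, and each class modulo rotation holds l listings, one for each
    state on the cycle. *)
Lemma card_fsr_cycles :
  (#|fsr_cycles f l| * l)%N = #|[set x | order (fsr_next f) x == l]|.
Proof.
rewrite -(card_imset _ cycle_from_inj) -fsr_cycle_seqsE.
apply: esym; apply: card_uniform_partition; last first.
  apply: equivalence_partitionP => s t u sD tD uD.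
  by rewrite !rot_equivE // eqxx; split=> // /eqP->.
move=> _ /imsetP[s sD ->].
have [_ uniq_s] : fcycle (fsr_next f) s /\ uniq s.
  by move: sD; rewrite inE => /andP.
rewrite -[RHS](size_tuple s) -(card_uniqP uniq_s) -[RHS]cardsE.
rewrite -(card_imset _ cycle_from_inj); apply: eq_card => t.
rewrite inE mem_rot_fsr_cycle //.
apply/andP/imsetP => [[_ /mapP[x xs ->]] | [x]].
  by exists x; rewrite ?inE.
rewrite inE => xs ->; split; last exact: map_f.
by rewrite fsr_cycle_seqsE; apply: imset_f; rewrite inE (order_fsr_cycle sD).
Qed.

End Cycles.

(** * Periodic sequences *)

Lemma addrr_F2 (x : 'F_2) : x + x = 0.
Proof. by apply: addrr_pchar2; apply: pchar_Fp. Qed.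

Lemma mulrn_F2 (x : 'F_2) (k : nat) : x *+ k = if odd k then x else 0.
Proof.
rewrite -{1}(odd_double_half k) mulrnDr -addnn mulrnDr addrr_F2 addr0.
by case: odd.
Qed.

Lemma sum_shift_periodic (V : nmodType) (u : nat -> V) (d : nat) :
    (forall j, u (j + d)%N = u j) ->
  \sum_(j < d) u j.+1 = \sum_(j < d) u j.
Proof.
case: d => [|d] u_per; first by rewrite !big_ord0.
rewrite big_ord_recr [RHS]big_ord_recl addrC /= -[d.+1]add0n u_per.
by congr (_ + _).
Qed.

Lemma sum_mul_periodic (V : nmodType) (u : nat -> V) (d k : nat) :
    (forall j, u (j + d)%N = u j) ->
  \sum_(j < k * d) u j = (\sum_(j < d) u j) *+ k.
Proof.
move=> u_per; elim: k => [|k IHk]; first by rewrite mul0n big_ord0.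
rewrite mulSnr big_split_ord /= IHk mulrSr; congr (_ + _).
apply: eq_bigr => j _; elim: k {IHk} => [//|k IHk].
by rewrite mulSn -addnA addnC u_per.
Qed.

(** * The complementary summing register as a cyclic shift *)

(** The word of odd weight attached to a state, as an (n+1)-periodic infinite
    sequence: this makes shifts free of wrap-around. The index n, the only
    residue outside 'I_n, carries the feedback bit. *)
Definition csr_word (n : nat) (a : state n) (j : nat) : 'F_2 :=
  if insub (j %% n.+1)%N is Some i then a 0 i else csr_feedback a.

Lemma csr_word_modn n (a : state n) j : csr_word a (j %% n.+1) = csr_word a j.
Proof. by rewrite /csr_word modn_mod. Qed.

Lemma csr_word_periodic n (a : state n) j : csr_word a (j + n.+1) = csr_word a j.
Proof. by rewrite -csr_word_modn modnDr csr_word_modn. Qed.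

Lemma csr_word_ord n (a : state n) (i : 'I_n) : csr_word a i = a 0 i.
Proof.
rewrite /csr_word modn_small ?ltnS 1?ltnW // insubT //= => lt_in.
by congr (a _ _); apply: val_inj.
Qed.

Lemma csr_word_last n (a : state n) : csr_word a n = csr_feedback a.
Proof. by rewrite /csr_word modn_small // insubF // ltnn. Qed.

Lemma sum_csr_word n (a : state n) : \sum_(j < n.+1) csr_word a j = 1.
Proof.
rewrite big_ord_recr /= csr_word_last.
under eq_bigr do rewrite csr_word_ord.
by rewrite addrCA addrr_F2 addr0.
Qed.

(** The constraint on the sum over a period forces the entry at index n, hence
    every odd-weight sequence is the word of its first n entries. *)
Lemma csr_word_row n (u : nat -> 'F_2) :
    (forall j, u (j + n.+1)%N = u j) -> \sum_(j < n.+1) u j = 1 ->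
  csr_word (\row_(i < n) u i) =1 u.
Proof.
move=> u_per sum_u j; have u_mod k : u (k %% n.+1)%N = u k.
  rewrite [in RHS](divn_eq k n.+1) addnC.
  by elim: (_ %/ _)%N => [|q IHq]; rewrite ?addn0 // mulSnr addnA u_per.
rewrite -csr_word_modn -u_mod; have := ltn_pmod j (ltn0Sn n).
rewrite ltnS leq_eqVlt => /predU1P[-> | lt_jn]; last first.
  by rewrite (csr_word_ord _ (Ordinal lt_jn)) mxE.
rewrite csr_word_last /csr_feedback -sum_u big_ord_recr /=.
by under [X in _ + X]eq_bigr do rewrite mxE; rewrite addrAC addrr_F2 add0r.
Qed.

Lemma csr_word_inj n (a b : state n) : csr_word a =1 csr_word b -> a = b.
Proof. by move=> eq_ab; apply/rowP => i; rewrite -!csr_word_ord. Qed.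

Notation csr_next n := (fsr_next (@csr_feedback n)).

(** The shift of a word is again a periodic sequence of odd weight, hence a
    word; its first n entries are those of the next state. *)
Lemma csr_word_next n (a : state n) j :
  csr_word (csr_next n a) j = csr_word a j.+1.
Proof.
suff -> : csr_next n a = \row_(i < n) csr_word a i.+1.
  rewrite (csr_word_row (u := csr_word a \o S)) //= => [k|].
    by rewrite -addSn csr_word_periodic.
  by rewrite sum_shift_periodic ?sum_csr_word //; apply: csr_word_periodic.
by apply/rowP => i; rewrite !mxE /csr_word modn_small // ltnS.
Qed.

Lemma csr_word_iter n (a : state n) m j :
  csr_word (iter m (csr_next n) a) j = csr_word a (j + m).
Proof.
by elim: m j => [|m IHm] j; rewrite ?addn0 //= csr_word_next IHm addnS.
Qed.

(** Moving forward by n more steps undoes a step, since words are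
    (n+1)-periodic. *)
Lemma csr_next_inj n : injective (csr_next n).
Proof.
move=> a b eq_ab; apply: csr_word_inj => j.
rewrite -csr_word_periodic -[RHS]csr_word_periodic addnS.
by rewrite -!csr_word_next eq_ab.
Qed.

Lemma csr_iter_fixP n (a : state n) m :
  reflect (forall j, csr_word a (j + m) = csr_word a j)
          (iter m (csr_next n) a == a).
Proof.
apply: (iffP eqP) => [fix_a j | per_a].
  by rewrite -csr_word_iter fix_a.
by apply: csr_word_inj => j; rewrite csr_word_iter.
Qed.

(** For (n+1)/d odd, the d-periodic words of CSR_n have odd weight over one
    period of length d, so they are the words of CSR_(d-1), whose states are
    easy to count. *)
Lemma card_csr_iter_fix n d : (d %| n.+1)%N ->
  #|[set a | iter d (csr_next n) a == a]| =
  if odd (n.+1 %/ d) then (2 ^ d.-1)%N else 0%N.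
Proof.
case: d => [|d d_dvd]; first by rewrite dvd0n.
have sum_per u : (forall j, u (j + d.+1)%N = u j) ->
    \sum_(j < n.+1) u j =
      if odd (n.+1 %/ d.+1) then \sum_(j < d.+1) u j else 0 :> 'F_2.
  move=> u_per; rewrite -mulrn_F2 -sum_mul_periodic //.
  by rewrite -!(big_mkord xpredT) divnK.
case: ifP => odd_nd; rewrite odd_nd in sum_per; last first.
  apply/eqP; rewrite cards_eq0; apply/eqP/setP => a; rewrite !inE.
  apply/negP => /csr_iter_fixP/sum_per/eqP.
  by rewrite sum_csr_word.
(* E identifies states with equal words; the period is now called d.+1. *)
pose E (v : state d) : state n := \row_(i < n) csr_word v i.
have word_E v : csr_word (E v) =1 csr_word v.
  apply: csr_word_row => [j|]; last first.
    by rewrite sum_per ?sum_csr_word //; apply: csr_word_periodic.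
  rewrite -csr_word_modn -[in RHS]csr_word_modn; congr csr_word.
  by rewrite -modnDmr (eqP d_dvd) addn0.
have E_inj : injective E.
  by move=> v w eq_vw; apply: csr_word_inj => j; rewrite -!word_E eq_vw.
have -> : [set a | iter d.+1 (csr_next n) a == a] = E @: setT.
  apply/setP => a; rewrite inE; apply/csr_iter_fixP/imsetP => [per_a | [v _ ->] j].
    exists (\row_(i < d) csr_word a i) => //; apply: csr_word_inj => j.
    by rewrite word_E csr_word_row // -(sum_csr_word a) [RHS]sum_per.
  by rewrite !word_E csr_word_periodic.
by rewrite card_imset // cardsT card_mx mul1n card_Fp.
Qed.

(** * The number of cycles *)

(** The common form of all the formulas. The sum runs over odd e because the
    cofactor of d/e in n+1 is e * (n+1)/d; the factor 2 turns the count
    2^(d/e-1) of fixed states into a power with exponent d/e. *)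
Lemma csr_num_cyclesE (n d : nat) : (d %| n.+1)%N -> odd (n.+1 %/ d) ->
  (csr_num_cycles n d)%:R =
    1 / (2 * d)%:R *
    \sum_(e <- divisors d | odd e) (moebius e)%:~R * 2 ^+ (d %/ e) :> rat.
Proof.
move=> d_dvd odd_nd; have d_gt0 := dvdn_gt0 (ltn0Sn n) d_dvd.
have neq0_2d : (2 * d)%:R != 0 :> rat.
  by rewrite Num.Theory.pnatr_eq0 muln_eq0 -lt0n d_gt0.
pose A e : rat := #|[set a | order (csr_next n) a == e]|%:R.
pose F e : rat := #|[set a | iter e (csr_next n) a == a]|%:R.
have inv : A d = \sum_(e <- divisors d) (moebius e)%:~R * F (d %/ e)%N.
  apply: moebius_inversion => // e e_dvd.
  rewrite /F card_iter_fix ?natr_sum //; first exact: csr_next_inj.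
  exact: dvdn_gt0 e_dvd.
have F_val e : (e %| d)%N ->
    2 * F (d %/ e)%N = if odd e then 2 ^+ (d %/ e) else 0.
  move=> e_dvd; have e_gt0 := dvdn_gt0 d_gt0 e_dvd.
  have de_gt0 : (0 < d %/ e)%N by rewrite divn_gt0 // dvdn_leq.
  rewrite /F card_csr_iter_fix; last by rewrite (dvdn_trans _ d_dvd) // dvdn_div.
  have -> : (n.+1 %/ (d %/ e) = n.+1 %/ d * e)%N.
    apply/eqP; rewrite -(eqn_pmul2r de_gt0) divnK.
      by rewrite -mulnA [(e * _)%N]mulnC divnK // divnK.
    by rewrite (dvdn_trans _ d_dvd) // dvdn_div.
  rewrite oddM odd_nd /=; case: ifP => _; last by rewrite mulr0.
  by rewrite natrX -exprS prednK.
have A_val : A d = (csr_num_cycles n d)%:R * d%:R.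
  by rewrite /A -(card_fsr_cycles (@csr_next_inj n) d_gt0) natrM.
apply: (mulfI neq0_2d); rewrite mulrA mulrA mulr1 divff // mul1r.
rewrite natrM -mulrA [d%:R * _]mulrC -A_val inv mulr_sumr [RHS]big_mkcond /=.
apply: eq_big_seq => e; rewrite -dvdn_divisors // => /F_val F_e.
by rewrite mulrCA F_e; case: ifP; rewrite ?mulr0.
Qed.

Theorem lemma2 (n : nat) (n_ge1 : (1 <= n)%N) :
  (~~ odd n ->
     forall d : nat, (d %| n.+1)%N ->
       (csr_num_cycles n d)%:R =
         1 / (2 * d)%:R *
         \sum_(d' <- divisors d) (moebius d')%:~R * 2 ^+ (d %/ d') :> rat)
  /\
  (odd n ->
     (forall k m d : nat, n.+1 = (2 ^ k * m)%N -> odd m -> (d %| m)%N ->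
        (csr_num_cycles n (2 ^ k * d))%:R =
          1 / (2 ^ k.+1 * d)%:R *
          \sum_(d' <- divisors d)
             (moebius d')%:~R * 2 ^+ ((2 ^ k * d) %/ d') :> rat)
     /\
     (forall d : nat, (d %| n.+1)%N -> odd (n.+1 %/ d) ->
        (csr_num_cycles n d)%:R =
          1 / (2 * d)%:R *
          \sum_(d' <- divisors d | odd d')
             (moebius d')%:~R * 2 ^+ (d %/ d') :> rat)).
Proof.
split=> [n_even d d_dvd | n_odd].
  rewrite csr_num_cyclesE //; last first.
    by apply: dvdn_odd (dvdn_div d_dvd) _.
  congr (_ * _); rewrite big_seq_cond [RHS]big_seq.
  apply: eq_bigl => e; rewrite -dvdn_divisors ?(dvdn_gt0 _ d_dvd) //.
  by apply: andb_idr => e_dvd; apply: dvdn_odd (dvdn_trans e_dvd d_dvd) _.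
split=> [k m d def_n m_odd d_dvd | d]; last exact: csr_num_cyclesE.
have m_gt0 := odd_gt0 m_odd; have d_gt0 := dvdn_gt0 m_gt0 d_dvd.
have d_odd := dvdn_odd d_dvd m_odd.
have D_gt0 : (0 < 2 ^ k * d)%N by rewrite muln_gt0 expn_gt0.
rewrite csr_num_cyclesE; first last.
- by rewrite def_n divnMl ?expn_gt0 // (dvdn_odd (dvdn_div d_dvd)).
- by rewrite def_n dvdn_pmul2l ?expn_gt0.
rewrite mulnA -expnS; congr (_ * _).
rewrite (big_divisors_dvdn _ D_gt0) ?dvdn_mull // big_seq_cond [RHS]big_seq_cond.
apply: eq_bigl => e; rewrite -dvdn_divisors //; case e_dvd: (e %| _)%N => //=.
apply/idP/idP => [e_odd | /dvdn_odd-> //].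
by rewrite -(@Gauss_dvdr e (2 ^ k)) // coprimeXr // coprimen2.
Qed.
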